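(* Let $\mathscr{F}$ be a sheaf of functions on $\Omega$ satisfying property $(\mathscr{F}1)$ and assume that the topology of $\mathscr{F}(Y)$ is the compact-open topology for every open $Y\subseteq\Omega$. Let $X\subseteq\Omega$ be open, let $w:X\to\mathbb{K}$ and $\psi:X\to X$ be continuous, and assume that the weighted composition operator $C_{w,\psi}:\mathscr{F}(X)\to\mathscr{F}(X)$, $f\mapsto w\cdot(f\circ\psi)$, is well-defined. Assume that $w\in\mathscr{F}(X)$ and that additionally the following conditions hold. (a) There is an open, relatively compact exhaustion $(X_n)_{n\in\mathbb{N}}$ of $X$ such that for each $n\in\mathbb{N}$, every $x\in X\setminus\overline{X}_n$ and every open $W\subseteq X\setminus\overline{X}_n$ containing $x$ there is an open $U\subseteq W$ with $x\in U$ for which the restriction $r_X^{X_n\cup U}:\mathscr{F}(X)\to\mathscr{F}(X_n\cup U)$ has dense range. (b) $\ker\delta_x\neq\mathscr{F}(X)$ for each $x\in X$. (c) For every $m\in\mathbb{N}_0$ the set $\{y\in X:\ w(\psi^m(y))\neq 0\}$ is dense in $X$. Then the following are equivalent. (i) $C_{w,\psi}$ is power bounded on $\mathscr{F}(X)$. (ii) $C_{w,\psi}$ is $m$-topologizable on $\mathscr{F}(X)$ and $\{C_{w,\psi}^m(w):\ m\in\mathbb{N}\}$ is bounded in $\mathscr{F}(X)$. (iii) $C_{w,\psi}$ is topologizable on $\mathscr{F}(X)$ and $\{C_{w,\psi}^m(w):\ m\in\mathbb{N}\}$ is bounded in $\mathscr{F}(X)$. (iv) $\psi$ has stable orbits and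 $\{C_{w,\psi}^m(w):\ m\in\mathbb{N}\}$ is bounded in $\mathscr{F}(X)$.
   Context: $\mathbb{K}\in\{\mathbb{R},\mathbb{C}\}$; $\Omega$ is a locally compact, $\sigma$-compact, non-compact Hausdorff space. A sheaf of functions $\mathscr{F}$ on $\Omega$ assigns to every open $X\subseteq\Omega$ a vector space $\mathscr{F}(X)$ of $\mathbb{K}$-valued functions on $X$ such that for open $Y\subseteq X$ the restriction $r_X^Y:\mathscr{F}(X)\to\mathscr{F}(Y)$, $f\mapsto f_{|Y}$, is well-defined, functions in $\mathscr{F}(X)$ agreeing on all members of an open cover of $X$ are equal, and for every open cover $(X_\iota)_{\iota\in I}$ of $X$ and $f_\iota\in\mathscr{F}(X_\iota)$ with $f_\iota=f_\kappa$ on $X_\iota\cap X_\kappa$ for all $\iota,\kappa\in I$ there is $f\in\mathscr{F}(X)$ with $f_{|X_\iota}=f_\iota$ for all $\iota$. An open, relatively compact exhaustion of $X$ is a sequence $(X_n)$ of open subsets of $X$ with compact closures $\overline{X}_n\subseteq X_{n+1}$ and $\bigcup_n X_n=X$. $\mathscr{F}$ satisfies $(\mathscr{F}1)$ if for every open $X\subseteq\Omega$: $\mathscr{F}(X)$ is a webbed and ultrabornological Hausdorff locally convex space; $\mathscr{F}(X)\subseteq C(X)$ (continuous $\mathbb{K}$-valued functions); for each $x\in X$ the point evaluation $\delta_x:f\mapsto f(x)$ is a continuous linear functional on $\mathscr{F}(X)$; and for every open, relatively compact exhaustion $(X_n)$ of $X$ the canonical map $f\mapsto(f_{|X_n})_n$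 is a topological isomorphism of $\mathscr{F}(X)$ onto the projective limit $\{(f_n)_n\in\prod_n\mathscr{F}(X_n):\ f_n=f_{n+1|X_n}\ \forall n\}$ (with the topology induced by the product). The compact-open topology is defined by the seminorms $\|f\|_K=\sup_{x\in K}|f(x)|$, $K\subseteq X$ compact. $\psi^m$ is the $m$-fold iterate of $\psi$ ($\psi^0=\mathrm{id}$). A continuous map $\psi:X\to X$ has stable orbits if for every compact $K\subseteq X$ there is a compact $L\subseteq X$ with $\psi^m(K)\subseteq L$ for all $m\in\mathbb{N}$. A continuous linear operator $T$ on a locally convex space $E$ is topologizable if for every continuous seminorm $p$ on $E$ there is a continuous seminorm $q$ on $E$ such that for every $m\in\mathbb{N}$ there is $\gamma_m>0$ with $p(T^m x)\le\gamma_m q(x)$ for all $x\in E$; $m$-topologizable if for every $p$ there are $q$ and $\gamma>0$ such that $p(T^m x)\le\gamma^m q(x)$ for all $m\in\mathbb{N}$, $x\in E$; power bounded if for every $p$ there is $q$ such that $p(T^m x)\le q(x)$ for all $m\in\mathbb{N}$, $x\in E$ (i.e. $\{T^m:m\in\mathbb{N}\}$ is equicontinuous). *)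

(* Defs.v *)
From HB Require Import structures.
From mathcomp Require Import all_boot all_order all_algebra.
From mathcomp Require Import all_classical all_reals all_analysis.
From mathcomp Require Import complex.

Set Implicit Arguments.
Unset Strict Implicit.
Unset Printing Implicit Defensive.

Import Order.TTheory GRing.Theory Num.Theory.

Local Open Scope classical_set_scope.
Local Open Scope ring_scope.
Local Open Scope complex_scope.

(* The norm of a numFieldType is valued in the field itself, and order
   comparability with 0 forces an element of R[i] to be real; hence nonnegative
   real quantities (seminorms, constants) are elements of K below. *)
Definition real_or_complex (K : numFieldType) : Prop :=
  exists R : realType, K = R :> numFieldType \/ K = R[i] :> numFieldType.

Definition sigma_compact (T : topologicalType) : Prop :=
  exists2 L : nat -> set T,
    forall n, compact (L n) & \bigcup_n L n = [set: T].

Section locally_convex.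
Context {K : numFieldType} {E : tvsType K}.

Definition absolutely_convex (D : set E) : Prop :=
  forall (a b : K) (x y : E), `|a| + `|b| <= 1 -> D x -> D y ->
    D (a *: x + b *: y).

(* [C [:: n1; ...; nk]] is the member of the web of index (n1, ..., nk); the
   empty index stands for the whole space. *)
Definition is_web (C : seq nat -> set E) : Prop :=
  [/\ C [::] = [set: E],
      forall s, C s = \bigcup_n C (rcons s n),
      forall s, absolutely_convex (C s) &
      forall a : nat -> nat, exists2 lambda : nat -> K,
        forall k, 0 < lambda k &
        forall x : nat -> E, (forall k, C (mkseq a k.+1) (x k)) ->
          exists l : E, series (fun k => lambda k *: x k) @ \oo --> l].

Definition bounded_in (B : set E) : Prop :=
  forall U : set E, nbhs (0 : E) U ->
    exists2 r : K, 0 < r & B `<=` [set r *: x | x in U].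

Definition continuous_seminorm (p : E -> K) : Prop :=
  [/\ forall x, 0 <= p x,
      forall x y, p (x + y) <= p x + p y,
      forall a x, p (a *: x) = `|a| * p x &
      continuous (p : E -> K^o)].

Definition continuous_operator (T : E -> E) : Prop :=
  linear T /\ continuous T.

Definition topologizable (T : E -> E) : Prop :=
  continuous_operator T /\
  forall p, continuous_seminorm p -> exists2 q, continuous_seminorm q &
    forall m, (0 < m)%N -> exists2 gamma : K, 0 < gamma &
      forall x, p (iter m T x) <= gamma * q x.

Definition m_topologizable (T : E -> E) : Prop :=
  continuous_operator T /\
  forall p, continuous_seminorm p -> exists2 q, continuous_seminorm q &
    exists2 gamma : K, 0 < gamma &
      forall m x, (0 < m)%N -> p (iter m T x) <= gamma ^+ m * q x.

Definition power_bounded (T : E -> E) : Prop :=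
  continuous_operator T /\
  forall p, continuous_seminorm p -> exists2 q, continuous_seminorm q &
    forall m x, (0 < m)%N -> p (iter m T x) <= q x.

End locally_convex.

Definition webbed (K : numFieldType) (E : tvsType K) : Prop :=
  exists C : seq nat -> set E, is_web C.

(* E carries the inductive locally convex topology of a family of Banach
   spaces; applied to the span of the ranges of the j_i, the last condition
   forces this span to be all of E. *)
Definition ultrabornological (K : numFieldType) (E : tvsType K) : Prop :=
  exists (I : Type) (G : I -> completeNormedModType K)
         (j : forall i, {linear G i -> E}),
    (forall i, continuous (j i)) /\
    forall U : set E, absolutely_convex U ->
      (forall i, nbhs (0 : G i) (j i @^-1` U)) -> nbhs (0 : E) U.

(* A locally convex space of K-valued functions on T: its elements are
   identified with functions through the injective linear map [fs_eval]. *)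
Record fspace (K : numFieldType) (T : Type) := FSpace {
  fs_tvs :> tvsType K;
  fs_eval : {linear fs_tvs -> (T -> K^o)};
  fs_eval_inj : injective fs_eval }.

Section fspace.
Context {K : numFieldType} {T : Type} {F : fspace K T}.

Definition ev (f : F) : T -> K^o := fs_eval F f.

Definition belongs (u : T -> K^o) : Prop := range ev u.

(* The element of F whose function is u, when there is one. *)
Definition to_fs (u : T -> K^o) : F := xget 0 [set f | ev f = u].

End fspace.
Arguments belongs {K T} F u.
Arguments to_fs {K T} F u.

Section function_sheaf.
Context {K : numFieldType} {Omega : topologicalType}.

(* For Y `<=` X this says that g is the restriction of f to Y. *)
Definition agree {X Y : set Omega} (f : X -> K^o) (g : Y -> K^o) : Prop :=
  forall (x : X) (y : Y), val x = val y -> f x = g y.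

(* The values on sets that are not open are never used. *)
Definition presheaf := forall X : set Omega, fspace K X.

Implicit Types (F : presheaf) (X Y : set Omega).

Definition is_sheaf F : Prop :=
  [/\ forall X Y, open X -> open Y -> Y `<=` X ->
        forall f : F X, exists g : F Y, agree (ev f) (ev g),
      forall X (I : Type) (U : I -> set Omega),
        open X -> (forall i, open (U i)) -> \bigcup_i U i = X ->
        forall f g : F X,
          (forall i (x : X), U i (val x) -> ev f x = ev g x) -> f = g &
      forall X (I : Type) (U : I -> set Omega),
        open X -> (forall i, open (U i)) -> \bigcup_i U i = X ->
        forall f : forall i, F (U i),
          (forall i k, agree (ev (f i)) (ev (f k))) ->
          exists g : F X, forall i, agree (ev g) (ev (f i))].

(* The restriction r_X^Y, for open Y `<=` X. *)
Definition restriction F X Y (f : F X) : F Y :=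
  xget 0 [set g : F Y | agree (ev f) (ev g)].

Definition exhaustion X (Xn : nat -> set Omega) : Prop :=
  [/\ forall n, open (Xn n),
      forall n, compact (closure (Xn n)),
      forall n, closure (Xn n) `<=` Xn n.+1 &
      \bigcup_n Xn n = X].

Definition proj_limit F (Xn : nat -> set Omega) :
    set (prod_topology (fun n => F (Xn n))) :=
  [set f | forall n, f n = restriction (Xn n) (f n.+1)].

Definition canonical_map F X (Xn : nat -> set Omega) (f : F X) :
    prod_topology (fun n => F (Xn n)) :=
  fun n => restriction (Xn n) f.

(* f is a homeomorphism of S onto the subspace P of T. *)
Definition homeomorphism_onto (S T : topologicalType) (f : S -> T)
    (P : set T) : Prop :=
  [/\ set_bij [set: S] P f, continuous f &
      forall A : set S, open A -> exists2 B : set T, open B & f @` A = P `&` B].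

Definition F1 F : Prop := forall X, open X ->
  [/\ webbed (F X) /\ ultrabornological (F X), hausdorff_space (F X),
      forall f : F X, continuous (ev f : X -> K^o),
      forall x : X, continuous (fun f : F X => ev f x : K^o) &
      forall Xn, exhaustion X Xn ->
        homeomorphism_onto (@canonical_map F X Xn) (@proj_limit F Xn)].

(* The seminorms f |-> sup_(x in L) |f x|, for L compact, define the topology
   of uniform convergence on compact sets, which F(X) inherits here. *)
Definition has_compact_open_topology F X : Prop :=
  @open (F X) = [set ev @^-1` V | V in @open {family compact, X -> K^o}].

Definition weighted_comp F X (w : X -> K^o) (psi : X -> X) (f : F X) : F X :=
  to_fs (F X) (fun x => w x * ev f (psi x)).

Definition wcomp_well_defined F X (w : X -> K^o) (psi : X -> X) : Prop :=
  forall f : F X, belongs (F X) (fun x => w x * ev f (psi x)).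

End function_sheaf.
Arguments presheaf K Omega : clear implicits.

Definition stable_orbits (T : topologicalType) (psi : T -> T) : Prop :=
  forall L : set T, compact L -> exists2 L' : set T, compact L' &
    forall m, (0 < m)%N -> iter m psi @` L `<=` L'.

(* Main.v *)
(* Neighbourhoods in F(Y) are given by sup-seminorms over compact sets, so each
   condition becomes a sup-norm estimate for
     C^m f = (\prod_(j < m) w o psi^j) * (f o psi^m).
   Topologizability bounds C^m f on a compact set by f on a compact L inside some
   X_n. If psi^m moved a point of that set outside the closure of X_n, (c) lets us
   perturb the point so that the product does not vanish there; gluing 0 on X_n
   with a function nonzero at the image point and approximating by density (a)
   gives f arbitrarily small on L but not at the image, a contradiction. Conversely, the
   products are w itself and C^(m-1) w, which are bounded by hypothesis, and stable
   orbits control the factors f o psi^m. *)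
Require Import Defs.
From mathcomp Require Import all_boot all_order all_algebra.
From mathcomp Require Import all_classical all_reals all_analysis.
From mathcomp Require Import complex ring.

Import Order.TTheory GRing.Theory Num.Theory.
Local Open Scope classical_set_scope.
Local Open Scope ring_scope.

(** * Bounds and suprema in a real or complex scalar field *)

Lemma compact_norm_bounded (K : numFieldType) (T : topologicalType)
    (f : T -> K^o) (L : set T) : continuous f -> compact L ->
  exists2 M : K, 0 < M & forall x, L x -> `|f x| <= M.
Proof.
move=> fc /compact_near_coveringP cL.
(* In its near-covering form, compactness reduces a common bound to a local one: near [x] the norm
   of [f] stays below [|f x| + 1], so every larger real [M] works there. *)
have : \forall M \near +oo_K, forall x, L x -> `|f x| <= M.
  apply: (cL K _ (fun M x => `|f x| <= M)) => x Lx.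
  exists ([set y | `|f x - f y| < 1], [set M : K | `|f x| + 1 <= M]) => /=.
    split.
      have := fc x; move/(_ _ (nbhsx_ballx (f x) 1 ltr01)).
      by apply.
    by apply: nbhs_pinfty_ge; rewrite ?realD ?normr_real.
  move=> [y M] /= [fxy xM].
  apply: le_trans xM; rewrite -lerBlDl; apply: le_trans (ltW fxy).
  by rewrite (le_trans (lerB_dist _ _))// distrC.
move=> H; near +oo_K => M; exists M; first by near: M; apply: nbhs_pinfty_gt.
by near: M.
Unshelve. all: by end_near. Qed.

(** The order of [R[i]] is only partial, but its nonnegative elements are real, so the supremum is
    taken in [R] and embedded. *)
Lemma real_or_complex_sup (K : numFieldType) (A : set K) :
  real_or_complex K -> (forall a, A a -> 0 <= a) ->
  (exists2 M, 0 <= M & forall a, A a -> a <= M) ->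
  exists s : K, [/\ 0 <= s, forall a, A a -> a <= s &
    forall t, 0 <= t -> (forall a, A a -> a <= t) -> s <= t].
Proof.
move=> [R hK] A0 [M M0 hM].
have sup_real (B : set R) : (forall a, B a -> 0 <= a) ->
    (exists M, forall a, B a -> a <= M) ->
    exists s : R, [/\ 0 <= s, forall a, B a -> a <= s &
      forall t, 0 <= t -> (forall a, B a -> a <= t) -> s <= t].
  move=> B0 [m hm].
  (* Adjoining 0 covers the empty set and makes the supremum nonnegative; this is why only bounds
     [t >= 0] compete with it. *)
  have hs : has_sup (B `|` [set 0]).
    split; first by exists 0; right.
    by exists (Num.max m 0) => x [/hm|->]; rewrite le_max ?lexx ?orbT// => ->.
  exists (sup (B `|` [set 0])); split.
  - by apply: sup_upper_bound => //; right.
  - by move=> a Ba; apply: sup_upper_bound => //; left.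
  - move=> t t0 ht; apply: ge_sup; first by case: hs.
    by move=> x [/ht//|->].
case: hK A A0 M M0 hM => ->; first by move=> A A0 M _ hM; apply: sup_real => //; exists M.
move=> A A0 M M0 hM.
have hRe (a : R[i]) : 0 <= a -> a = ((complex.Re a)%:C)%C.
  by case: a => x y; rewrite lecE /= => /andP[/eqP -> _].
have [||s [s0 sA st]] := sup_real [set r | A (r%:C)%C].
- by move=> a /A0; rewrite lecR.
- by exists (complex.Re M) => a /hM; rewrite (hRe _ M0) lecR.
- exists (s%:C)%C; split; first by rewrite lecR.
   move=> a Aa; rewrite (hRe _ (A0 _ Aa)) lecR; apply: sA => /=.
   by rewrite -hRe// A0.
  move=> t t0 ht; rewrite (hRe _ t0) lecR; apply: st.
    by rewrite -lecR -hRe.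
  by move=> a /ht; rewrite {1}(hRe _ t0) lecR.
Qed.

(** * The compact-open topology through sup-norm estimates *)

(** For the direct implication, the sets containing a sup-ball around [f] form a filter [G]; it
    converges to [f] uniformly on each compact set, so it contains every neighbourhood of [f]. *)
Lemma family_compact_nbhsP (K : numFieldType) (T : topologicalType)
    (f : {family compact, T -> K^o}) (U : set {family compact, T -> K^o}) :
  nbhs f U <-> exists2 L : set T, compact L & exists2 e : K, 0 < e &
    [set g : T -> K^o | forall x, L x -> `|f x - g x| < e] `<=` U.
Proof.
split; last first.
  move=> [L cL [e e0 LU]].
  apply: filterS LU _.
  apply: (@fam_nbhs _ _ _ L [set xy | `|xy.1 - xy.2| < e]) => //.
  by rewrite -entourage_from_ballE; exists e => //= -[x y] /=; rewrite -ball_normE.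
pose G : set_system (T -> K^o) := [set V : set (T -> K^o) |
  exists2 L : set T, compact L & exists2 e : K, 0 < e &
    [set g : T -> K^o | forall x, L x -> `|f x - g x| < e] `<=` V].
have FG : Filter G.
  split.
  - by exists set0; [exact: compact0|exists 1].
  - move=> A B [L cL [e e0 LA]] [M cM [d d0 MB]].
    exists (L `|` M); first exact: compactU.
    (* Positive elements are real, hence comparable, which provides the smaller radius. *)
    have [c [c0 ce cd]] : exists c, [/\ 0 < c, c <= e & c <= d].
      have [ed|/ltW de] := real_leP (gtr0_real e0) (gtr0_real d0).
        by exists e; rewrite e0 lexx ed.
      by exists d; rewrite d0 lexx de.
    exists c => // g /= hg; split; [apply: LA|apply: MB] => x hx.
      by apply: lt_le_trans ce; apply: hg; left.
    by apply: lt_le_trans cd; apply: hg; right.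
  - by move=> A B AB [L cL [e e0 LA]]; exists L => //; exists e => //; apply: subset_trans AB.
suff : {family compact, G --> f} by move=> /(_ U) H /H.
apply/fam_cvgP => L cL V /uniform_nbhs[E [+ EV]].
rewrite -entourage_from_ballE => -[e /= e0 eE].
exists L => //; exists e => // g hg; apply: EV => x Lx; apply: eE; rewrite -ball_normE; exact: hg.
Qed.

Lemma fs_nbhsP (K : numFieldType) (Omega : topologicalType)
    (F : presheaf K Omega) (Y : set Omega) (f : F Y) (U : set (F Y)) :
  has_compact_open_topology F Y ->
  nbhs f U <-> exists2 L : set Y, compact L & exists2 e : K, 0 < e &
    [set g : F Y | forall x, L x -> `|ev f x - ev g x| < e] `<=` U.
Proof.
move=> hco; split.
- rewrite nbhsE => -[B [oB Bf] BU].
  move: oB; rewrite hco => -[V oV VB].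
  have : nbhs (ev f : {family compact, Y -> K^o}) V.
    by apply: open_nbhs_nbhs; split => //; move: Bf; rewrite -VB.
  move/family_compact_nbhsP => [L cL [e e0 LV]]; exists L => //; exists e => //.
  by move=> g hg; apply: BU; rewrite -VB; apply: LV.
- move=> [L cL [e e0 LU]].
  have : nbhs (ev f : {family compact, Y -> K^o}) [set g | forall x, L x -> `|ev f x - g x| < e].
    by apply/family_compact_nbhsP; exists L => //; exists e.
  rewrite nbhsE => -[V [oV Vf] VU].
  rewrite nbhsE; exists (ev @^-1` V); last by move=> g /VU; apply: LU.
  by split => //; rewrite hco; exists V.
Qed.

(** The value [p f] is the least nonnegative bound of [f] on [L]; the seminorm inequalities all
    follow from this minimality. *)
Lemma sup_seminorm (K : numFieldType) (Omega : topologicalType)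
    (F : presheaf K Omega) (Y : set Omega) (L : set Y) :
  real_or_complex K -> has_compact_open_topology F Y ->
  (forall f : F Y, continuous (ev f : Y -> K^o)) -> compact L ->
  exists2 p : F Y -> K, continuous_seminorm p &
    (forall f x, L x -> `|ev f x| <= p f) /\
    (forall f t, 0 <= t -> (forall x, L x -> `|ev f x| <= t) -> p f <= t).
Proof.
move=> hK hco evc cL.
have : forall f : F Y, exists s : K, [/\ 0 <= s,
    forall x, L x -> `|ev f x| <= s &
    forall t, 0 <= t -> (forall x, L x -> `|ev f x| <= t) -> s <= t].
  move=> f; have [M M0 hM] := compact_norm_bounded _ _ _ _ (evc f) cL.
  have [||s [s0 sA st]] :=
      @real_or_complex_sup K [set `|ev f x| | x in L] hK.
  - by move=> _ [x _ <-].
  - by exists M; [exact: ltW|move=> _ [x Lx <-]; exact: hM].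
  - exists s; split => // [x Lx|t t0 ht]; first by apply: sA; exists x.
    by apply: st => // _ [x Lx <-]; exact: ht.
move=> /choice[p hp].
have p0 f : 0 <= p f by case: (hp f).
have evp f x : L x -> `|ev f x| <= p f by case: (hp f) => _ + _; apply.
have pt f t : 0 <= t -> (forall x, L x -> `|ev f x| <= t) -> p f <= t.
  by case: (hp f) => _ _; apply.
have pD f g : p (f + g) <= p f + p g.
  apply: pt; first exact: addr_ge0.
  move=> x Lx; rewrite /ev linearD /=; apply: le_trans (ler_normD _ _) _.
  by apply: lerD; exact: evp.
have pZle a f : p (a *: f) <= `|a| * p f.
  apply: pt; first exact: mulr_ge0.
  move=> x Lx; rewrite /ev linearZ /= normrM.
  by apply: ler_wpM2l => //; exact: evp.
have pN f : p (- f) <= p f by rewrite -scaleN1r (le_trans (pZle _ _))// normrN1 mul1r.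
exists p; last by [].
split => //.
  move=> a f; apply/eqP; rewrite eq_le pZle /=.
  (* The reverse inequality is [pZle] for the scalar [a^-1] and the vector [a *: f]. *)
  have [->|a0] := eqVneq a 0; first by rewrite normr0 mul0r.
  have := pZle a^-1 (a *: f); rewrite scalerA mulVf// scale1r => h.
  by rewrite -ler_pdivlMl ?normr_gt0// -normfV.
move=> f U /nbhs_ballP[e /= e0 eU].
apply: filterS eU _; apply/fs_nbhsP => //.
(* Minimality only yields a non-strict bound; radius [e / 2] keeps it strictly below [e]. *)
exists L => //; exists (e / 2); first by rewrite divr_gt0.
move=> g hg; rewrite -ball_normE /=.
have pfg : p (f - g) <= e / 2.
  apply: pt; first by rewrite divr_ge0 ?ltW.
  by move=> x Lx; rewrite /ev linearB /=; apply: ltW; exact: hg.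
apply: le_lt_trans (_ : _ <= e / 2) _; last by rewrite ltr_pdivrMr// ltr_pMr// ltr1n.
rewrite real_ler_norml; last by rewrite realB ?ger0_real.
have pf : p f <= p (f - g) + p g by rewrite -{1}(subrK g f).
have pg : p g <= p (f - g) + p f.
  have := pD (- (f - g)) f; rewrite opprB subrK => /le_trans; apply.
  by rewrite lerD2r -opprB.
rewrite lerNl opprB !lerBlDr.
by rewrite (le_trans pf) ?(le_trans pg) ?lerD2r.
Qed.

(** Continuity at 0 gives [p < 1] on a sup-ball of radius [e] over some compact [L], and homogeneity
    makes this a linear estimate. An arbitrary bound [t] stands in for the supremum over [L], so
    none has to be formed. *)
Lemma continuous_seminorm_le (K : numFieldType) (Omega : topologicalType)
    (F : presheaf K Omega) (Y : set Omega) (p : F Y -> K) :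
  has_compact_open_topology F Y -> continuous_seminorm p ->
  exists2 L : set Y, compact L & exists2 c : K, 0 < c &
    forall f t, 0 <= t -> (forall x, L x -> `|ev f x| <= t) -> p f <= c * t.
Proof.
move=> hco [p_ge0 pD pZ pc].
have p0 : p 0 = 0 by rewrite -(scale0r 0) pZ normr0 mul0r.
have : nbhs (0 : F Y) [set f | p f < 1].
  apply: filterS; last exact: (pc 0 _ (nbhsx_ballx (p 0 : K^o) 1 ltr01)).
  move=> f /=; rewrite -ball_normE /= p0 sub0r normrN.
  by rewrite ger0_norm.
move=> /(fs_nbhsP _ _ _ _ _ _ hco)[L cL [e e0 eL]].
(* If [|f| <= t] on [L], then [f] scaled by [e / (2 * t)] is at most [e / 2 < e] there. *)
exists L => //; exists (2 / e); first by rewrite divr_gt0.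
have main f t : 0 < t -> (forall x, L x -> `|ev f x| <= t) -> p f <= 2 / e * t.
  move=> t0 ht.
  have a0 : 0 < e / (2 * t) by rewrite divr_gt0 ?mulr_gt0.
  have : p ((e / (2 * t)) *: f) < 1.
    apply: eL => x Lx; rewrite /ev linear0 linearZ /= sub0r normrN normrM.
    rewrite (gtr0_norm a0) mulrAC ltr_pdivrMr ?mulr_gt0// ltr_pM2l//.
    apply: le_lt_trans (ht x Lx) _.
    by rewrite ltr_pMl// ltr1n.
  rewrite pZ (gtr0_norm a0) mulrC -ltr_pdivlMr// mul1r invf_div => /ltW.
  by rewrite mulrAC.
(* The case [t = 0] is reached by enlarging [t] by [d / (2 / e)], which costs exactly [d]. *)
move=> f t t0 ht; apply/ler_addgt0Pr => d d0.
have d'0 : 0 < d / (2 / e) by rewrite !divr_gt0.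
have td : t <= t + d / (2 / e) by rewrite lerDl ltW.
apply: le_trans (main f (t + d / (2 / e)) _ _) _.
- by rewrite ltr_wpDl.
- by move=> x /ht /le_trans; apply.
- by rewrite mulrDr [X in _ + X <= _]mulrCA divff ?mulr1// gt_eqF// divr_gt0.
Qed.

Lemma bounded_in_fsP (K : numFieldType) (Omega : topologicalType)
    (F : presheaf K Omega) (Y : set Omega) (B : set (F Y)) :
  has_compact_open_topology F Y ->
  bounded_in B <-> forall L : set Y, compact L -> exists2 M : K, 0 < M &
    forall f x, B f -> L x -> `|ev f x| <= M.
Proof.
move=> hco; split.
  move=> bB L cL.
  have [|r r0 Br] := bB [set f : F Y | forall x, L x -> `|ev f x| < 1].
    apply/fs_nbhsP => //; exists L => //; exists 1 => // f hf x Lx.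
    by have := hf x Lx; rewrite /ev linear0 sub0r normrN.
  exists r => // f x /Br[g hg <-] Lx; rewrite /ev linearZ /= normrM gtr0_norm//.
  by rewrite -[leRHS]mulr1 ler_pM2l// ltW// hg.
move=> hB U /(fs_nbhsP _ _ _ _ _ _ hco)[L cL [e e0 eU]].
have [M M0 hM] := hB L cL.
(* Dividing by [2 * M / e] brings the bound [M] on [L] down to [e / 2]. *)
have r0 : 0 < 2 * M / e by rewrite divr_gt0 ?mulr_gt0.
exists (2 * M / e) => // f Bf; exists ((2 * M / e)^-1 *: f); last first.
  by rewrite scalerA divff ?scale1r// gt_eqF.
apply: eU => x Lx; rewrite /ev linear0 linearZ /= sub0r normrN normrM.
rewrite gtr0_norm ?invr_gt0// mulrC ltr_pdivrMr// mulrCA divff ?gt_eqF// mulr1.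
by apply: le_lt_trans (hM f x Bf Lx) _; rewrite ltr_pMl// ltr1n.
Qed.

(** * Compact sets in a subspace and in the ambient space; exhaustions *)

Lemma compact_set_val_image (Omega : topologicalType) (X : set Omega) (L : set X) :
  compact L -> compact (set_val @` L).
Proof.
move=> cL; apply: continuous_compact => //.
exact/continuous_subspaceT/initial_continuous.
Qed.

Lemma compact_set_val_preimage (Omega : topologicalType) (X K : set Omega) :
  compact K -> K `<=` X -> compact (set_val @^-1` K : set X).
Proof.
move=> cK KX G PG GK.
(* The filter pushed forward to the ambient space clusters at some [p] in [K]. As [p] lies in [X]
   and subspace neighbourhoods are traces of open sets, [G] clusters there too. *)
have [|p [Kp clp]] := cK (set_val @ G) _ _; first by [].
exists (SigSub (mem_set (KX _ Kp))); split => //.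
move=> A B GA.
move=> [_ [[B' oB' <-] /= B'p] BB].
have GA' : G (set_val @^-1` (set_val @` A)) by apply: filterS GA => x Ax; exists x.
have nB' : nbhs p B' by apply: open_nbhs_nbhs; split.
have [_ [[x Ax <-] B'x]] := clp _ _ GA' nB'.
by exists x; split => //; apply: BB.
Qed.

Lemma compact_sub_exhaustion (Omega : topologicalType) (X : set Omega)
    (Xn : nat -> set Omega) (L : set X) : exhaustion X Xn -> compact L ->
  exists n, set_val @` L `<=` Xn n.
Proof.
move=> [oX _ XS XU] /compact_set_val_image /compact_near_coveringP cL.
have mono m n : (m <= n)%N -> Xn m `<=` Xn n.
  elim: n => [|n IH]; first by rewrite leqn0 => /eqP ->.
  rewrite leq_eqVlt => /predU1P[->//|/IH h]; apply: subset_trans h _.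
  by apply: subset_trans (XS n); exact: subset_closure.
have : \forall n \near \oo, set_val @` L `<=` Xn n.
  apply: (cL _ _ (fun n x => Xn n x)) => _ [x Lx <-].
  have : (\bigcup_n Xn n) (set_val x) by rewrite XU; exact: set_valP.
  move=> [m _ mx].
  exists (Xn m, [set n | (m <= n)%N]) => /=.
    split; first exact: open_nbhs_nbhs.
    exact: nbhs_infty_ge.
  by move=> [y n] /= [my mn]; apply: mono mn _ my.
by move=> [n _ hn]; exists n; apply: hn => /=.
Qed.

(** * Iterates of the weighted composition operator *)

Lemma ev_to_fs (K : numFieldType) (T : Type) (G : fspace K T) (u : T -> K^o) :
  belongs G u -> ev (to_fs G u) = u.
Proof. by move=> [f _ fu]; apply: (@xgetPex _ 0 [set f | ev f = u]); exists f. Qed.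

Lemma continuous_iter (T : topologicalType) (f : T -> T) (m : nat) :
  continuous f -> continuous (iter m f).
Proof.
move=> fc; elim: m => [|m IH] x; first exact: cvg_id.
exact: (continuous_comp (IH x) (fc _)).
Qed.

Lemma ev_iter_weighted_comp (K : numFieldType) (Omega : topologicalType)
    (F : presheaf K Omega) (X : set Omega) (w : X -> K^o) (psi : X -> X) :
  wcomp_well_defined F w psi -> forall m (f : F X) x,
  ev (iter m (weighted_comp w psi) f) x =
    (\prod_(j < m) w (iter j psi x)) * ev f (iter m psi x).
Proof.
move=> Cd m f; elim: m => [|m IH] x; first by rewrite big_ord0 mul1r.
rewrite iterS ev_to_fs ?IH; last exact: Cd.
rewrite big_ord_recl -iterSr mulrA; congr (_ * _ * _).
by apply: eq_bigr => j _; rewrite -iterSr.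
Qed.

Lemma continuous_operator_weighted_comp (K : numFieldType)
    (Omega : topologicalType) (F : presheaf K Omega) (X : set Omega)
    (w : X -> K^o) (psi : X -> X) :
  has_compact_open_topology F X -> continuous w -> continuous psi ->
  wcomp_well_defined F w psi ->
  continuous_operator (weighted_comp w psi : F X -> F X).
Proof.
move=> hco wc psic Cd.
have evC (f : F X) : ev (weighted_comp w psi f) = fun x => w x * ev f (psi x).
  by rewrite ev_to_fs.
split.
  have evP a (f g : F X) : ev (a *: f + g) = a *: ev f + ev g by exact: linearP.
  move=> a f g; apply: (@fs_eval_inj _ _ (F X)); rewrite -!/(ev _).
  rewrite evP !evC evP; apply/funext => x /=.
  by rewrite mulrDr mulrCA.
move=> f U /(fs_nbhsP _ _ _ _ _ _ hco)[L cL [e e0 eU]].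
have [M M0 hM] := compact_norm_bounded _ _ _ _ wc cL.
apply/fs_nbhsP => //; exists (psi @` L).
  apply: continuous_compact => //; exact: continuous_subspaceT.
exists (e / M); first exact: divr_gt0.
move=> g hg; apply: eU => x Lx; rewrite !evC -mulrBr normrM.
apply: le_lt_trans (_ : M * `|ev f (psi x) - ev g (psi x)| < _).
  by apply: ler_wpM2r => //; exact: hM.
by rewrite mulrC -ltr_pdivlMr//; apply: hg; exists x.
Qed.

(** Dense sets need not meet densely, but these are also open by continuity. A point where the last
    factor is nonzero is moved, within the open set where it stays nonzero, to one where the earlier
    factors do not vanish either. *)
Lemma dense_iter_prod_neq0 (K : numFieldType) (T : topologicalType)
    (w : T -> K^o) (psi : T -> T) :
  continuous w -> continuous psi ->
  (forall m, dense [set y | w (iter m psi y) <> 0]) ->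
  forall m, dense [set y | \prod_(j < m) w (iter j psi y) != 0].
Proof.
move=> wc psic wd; elim=> [|m IH] O [x Ox] oO.
  by exists x; split => //=; rewrite big_ord0 oner_neq0.
have o0 : open [set y | w (iter m psi y) <> 0].
  have := @closed_openC K^o [set 0].
  move=> /(_ (@accessible_closed_set1 _ (hausdorff_accessible (@norm_hausdorff K K^o)) 0)) oC.
  apply: (@open_comp _ _ (fun y => w (iter m psi y)) (~` [set 0])) => // y _.
  exact: (continuous_comp (continuous_iter _ _ m psic y) (wc _)).
have [y [Oy wy]] := wd m O (ex_intro _ x Ox) oO.
have [z [[Oz wz] pz]] := IH _ (ex_intro _ y (conj Oy wy)) (openI oO o0).
by exists z; split => //=; rewrite big_ord_recr /= mulf_neq0//; apply/eqP.
Qed.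

(** * Gluing and approximation in the sheaf *)

Lemma agree_restriction (K : numFieldType) (Omega : topologicalType)
    (F : presheaf K Omega) (X Y : set Omega) : is_sheaf F ->
  open X -> open Y -> Y `<=` X ->
  forall f : F X, agree (ev f) (ev (restriction Y f : F Y)).
Proof.
move=> [hr _ _] oX oY YX f; have [g fg] := hr X Y oX oY YX f.
by apply: (@xgetPex _ 0 [set g : F Y | agree (ev f) (ev g)]); exists g.
Qed.

Lemma glue_zero (K : numFieldType) (Omega : topologicalType)
    (F : presheaf K Omega) (V U : set Omega) : is_sheaf F ->
  open V -> open U -> V `&` U = set0 ->
  forall f : F U, exists g : F (V `|` U),
    (forall y, V (val y) -> ev g y = 0) /\ agree (ev g) (ev f).
Proof.
move=> [_ _ glue] oV oU VU f.
pose W (b : bool) := if b then V else U.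
pose h (b : bool) : F (W b) := match b with true => 0 | false => f end.
have oW b : open (W b) by case: b.
have UW : \bigcup_b W b = V `|` U.
  apply/seteqP; split=> [x [[] _ Wx]|x [Vx|Ux]]; [by left|by right| |].
    by exists true. by exists false.
have disj (x : V) (y : U) : val x <> val y.
  move=> xy; suff : set0 (val x) by []. 
  by rewrite -VU; split; [|rewrite xy]; exact: set_valP.
have hh b c : agree (ev (h b)) (ev (h c)).
  case: b c => -[] x y xy //=; first by rewrite /ev !linear0.
  - by have := disj _ _ xy.
  - by have := disj _ _ (esym xy).
  - by congr (ev _ _); exact: val_inj.
have [g hg] := glue _ _ W (openU oV oU) oW UW h hh.
exists g; split; last exact: (hg false).
move=> y Vy; rewrite (hg true y (SigSub (mem_set Vy)) erefl).
by rewrite /ev linear0.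
Qed.

Lemma approx_peak (K : numFieldType) (Omega : topologicalType)
    (F : presheaf K Omega) (X V U : set Omega) (L : set X) (y : X) (e : K) :
  is_sheaf F -> has_compact_open_topology F (V `|` U) ->
  open X -> open V -> open U -> V `|` U `<=` X -> V `&` U = set0 ->
  dense (range (@restriction _ _ F X (V `|` U))) ->
  compact L -> set_val @` L `<=` V -> U (val y) ->
  [set f : F X | ev f y = 0] <> [set: F X] -> 0 < e ->
  exists k : F X, (forall x, L x -> `|ev k x| <= e) /\ 1 <= `|ev k y|.
Proof.
move=> hs hco oX oV oU VUX VU dns cL LV Uy hy e0.
have [f0 f0y] : exists f : F X, ev f y != 0.
  apply: contra_notP hy => h; apply/seteqP; split => // f _ /=.
  by apply/eqP; apply: contra_notT h => fy; exists f.
(* The value 2 at [y] leaves modulus at least 1 after an approximation error of at most 1; hence the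
   radius [c] below both [e] and 1. *)
pose f := (2 / ev f0 y) *: f0.
have fy : ev f y = 2 by rewrite /ev linearZ /=; exact: divfK.
have UX : U `<=` X by apply: subset_trans VUX; exact: subsetUr.
have [g [gV gU]] := glue_zero _ _ _ _ _ hs oV oU VU (restriction U f : F U).
have VUy : (V `|` U) (val y) by right.
pose y' : (V `|` U) := SigSub (mem_set VUy).
have gy : ev g y' = 2.
  rewrite (gU y' (SigSub (mem_set Uy)) erefl) -fy; symmetry.
  exact: (agree_restriction _ _ _ _ _ hs oX oU UX).
(* Adding [y] to [L] lets one approximation control both the smallness on [L] and the value at
   [y]. *)
pose L' : set (V `|` U) := set_val @^-1` (set_val @` L `|` [set val y]).
have cL' : compact L'.
  apply: compact_set_val_preimage.
    by apply: compactU; [exact: compact_set_val_image|exact: compact_set1].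
  by move=> x [/LV Vx|->//]; left.
have [c [c0 ce c1]] : exists c, [/\ 0 < c, c <= e & c <= 1].
  have [e1|/ltW e1] := real_leP (gtr0_real e0) (@real1 K).
    by exists e.
  by exists 1; rewrite ltr01 lexx e1.
have : nbhs g [set h : F (V `|` U) | forall x, L' x -> `|ev g x - ev h x| < c].
  by apply/fs_nbhsP => //; exists L' => //; exists c.
rewrite nbhsE => -[B [oB Bg] Bsub].
have [h [/Bsub /= hB [k _ kh]]] := dns B (ex_intro _ g Bg) oB.
have kag := agree_restriction _ _ _ _ _ hs oX (openU oV oU) VUX k.
rewrite kh in kag.
exists k; split.
  move=> x Lx.
  have Vx : V (val x) by apply: LV; exists x.
  have VUx : (V `|` U) (val x) by left.
  pose x' : (V `|` U) := SigSub (mem_set VUx).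
  rewrite (kag x x' erefl); apply: le_trans ce; apply: ltW.
  have := hB x'; rewrite gV// sub0r normrN; apply.
  by left; exists x.
rewrite (kag y y' erefl).
have h2 : `|2 - ev h y'| <= 1.
  by apply: le_trans c1; rewrite -gy; apply/ltW/hB; right.
have : `|2| <= `|2 - ev h y'| + `|ev h y'|.
  by apply: le_trans (ler_normD _ _); rewrite subrK.
rewrite gtr0_norm// => h2y; rewrite -(lerD2l 1).
by apply: le_trans h2y _; rewrite lerD2r.
Qed.

(** * Stable orbits, power boundedness and the equivalences *)

Lemma topologizable_stable_orbits (K : numFieldType) (Omega : topologicalType)
  (F : presheaf K Omega) (X : set Omega) (w : X -> K^o) (psi : X -> X)
  (hK : real_or_complex K)
  (F_sheaf : is_sheaf F)
  (F_evc : forall f : F X, continuous (ev f : X -> K^o))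
  (F_co : forall Y : set Omega, open Y -> has_compact_open_topology F Y)
  (X_open : open X)
  (w_cont : continuous w)
  (psi_cont : continuous psi)
  (C_def : wcomp_well_defined F w psi)
  (cond_a : exists2 Xn : nat -> set Omega, exhaustion X Xn &
    forall n (x : Omega), (X `\` closure (Xn n)) x ->
    forall W : set Omega, open W -> W `<=` X `\` closure (Xn n) -> W x ->
    exists U : set Omega, [/\ open U, U `<=` W, U x &
      dense (range (@restriction _ _ F X (Xn n `|` U)))])
  (cond_b : forall x : X, [set f : F X | ev f x = 0] <> [set: F X])
  (cond_c : forall m : nat, dense [set y : X | w (iter m psi y) <> 0]) :
  topologizable (weighted_comp w psi : F X -> F X) -> stable_orbits psi.
Proof.
move=> [_ Ct] L cL; case: cond_a => Xn Xexh dns.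
have [oXn cXn clXn XnU] := Xexh.
have XnX n : closure (Xn n) `<=` X.
  by move=> x /clXn xn; rewrite -XnU; exists n.+1.
have compact_cl n : compact (set_val @^-1` closure (Xn n) : set X).
  exact: compact_set_val_preimage.
have [l Ll] := compact_sub_exhaustion _ _ _ _ Xexh cL.
(* The seminorm is taken over the closure of [Xn l] rather than over [L], since the perturbed point
   below is only known to stay in [Xn l]. *)
have [p pC [evp _]] := sup_seminorm _ _ _ _ _ hK (F_co X X_open) F_evc (compact_cl l).
have [q qC pq] := Ct p pC.
have [M cM [c c0 qc]] := continuous_seminorm_le _ _ _ _ _ (F_co X X_open) qC.
have [n Mn] := compact_sub_exhaustion _ _ _ _ Xexh cM.
(* The index [n] depends only on [q], which serves all [m]; only the constant [g] varies with
   [m]. *)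
exists (set_val @^-1` closure (Xn n)) => // m m0 _ [x0 Lx0 <-] /=.
apply: contrapT => x0n.
pose D := ~` closure (Xn n).
have oD : open D by apply: closed_openC; exact: closed_closure.
pose O : set X := (set_val @^-1` Xn l) `&` (iter m psi @^-1` (set_val @^-1` D)).
have oO : open O.
  apply: openI; first by exists (Xn l).
  apply: open_comp; last by exists D.
  by move=> x _; exact: continuous_iter.
have Ox0 : O x0 by split => //; apply: Ll; exists x0.
have [x [[xl xD] /= Px]] :=
  dense_iter_prod_neq0 _ _ _ _ w_cont psi_cont cond_c m O (ex_intro _ x0 Ox0) oO.
have yX : (X `\` closure (Xn n)) (val (iter m psi x)).
  by split => //; exact: set_valP.
have [U [oU UD Uy dU]] := dns n _ yX _ (openI X_open oD) (@subset_refl _ _) yX.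
have [g g0 hg] := pq m m0.
set P := \prod_(j < m) w (iter j psi x) in Px.
have P0 : 0 < `|P| by rewrite normr_gt0.
(* With this radius [g * q k] is at most [|P| / 2], while [|P|] bounds [p] of the iterate from below
   because [|k| >= 1] at the image point. *)
have e0 : 0 < `|P| / (2 * (g * c)) by rewrite divr_gt0// !mulr_gt0.
have [||k [kM ky]] := approx_peak _ _ _ _ _ _ M _ _ F_sheaf
    (F_co _ (openU (oXn n) oU)) X_open (oXn n) oU _ _ dU cM Mn Uy (cond_b _) e0.
- move=> z [Xz|/UD[]//]; apply: (XnX n); exact: subset_closure.
- by apply/seteqP; split => // z [zn /UD[_]]; apply; exact: subset_closure.
have : `|P| <= g * (c * (`|P| / (2 * (g * c)))).
  apply: (@le_trans _ _ (p (iter m (weighted_comp w psi) k))); last first.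
    apply: le_trans (hg k) _; rewrite ler_pM2l//; apply: qc => //; exact: ltW.
  apply: le_trans (evp _ x _); last exact: subset_closure.
  by rewrite ev_iter_weighted_comp// normrM ler_peMr.
have -> : g * (c * (`|P| / (2 * (g * c)))) = `|P| / 2.
  by field; rewrite !gt_eqF.
by rewrite ler_pdivlMr// ger_pMr// (ler_nat _ 2 1).
Qed.

Lemma stable_orbits_power_bounded (K : numFieldType) (Omega : topologicalType)
  (F : presheaf K Omega) (X : set Omega) (w : X -> K^o) (psi : X -> X)
  (hK : real_or_complex K)
  (F_evc : forall f : F X, continuous (ev f : X -> K^o))
  (F_co : has_compact_open_topology F X)
  (w_cont : continuous w)
  (psi_cont : continuous psi)
  (C_def : wcomp_well_defined F w psi)
  (w_F : belongs (F X) w) :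
  stable_orbits psi ->
  bounded_in [set iter m (weighted_comp w psi) (to_fs (F X) w) |
    m in [set m | (0 < m)%N]] ->
  power_bounded (weighted_comp w psi : F X -> F X).
Proof.
move=> so /(bounded_in_fsP _ _ _ _ _ F_co) bw.
split; first exact: continuous_operator_weighted_comp.
move=> p pC.
have [L cL [c c0 pc]] := continuous_seminorm_le _ _ _ _ _ F_co pC.
have [L' cL' psiL] := so L cL.
have [s [s_ge0 sD sZ sc] [evs _]] := sup_seminorm _ _ _ _ _ hK F_co F_evc cL'.
have [M M0 hM] := bw L cL.
have [N N0 hN] := compact_norm_bounded _ _ _ _ w_cont cL.
have MN0 : 0 <= c * (M + N) by rewrite mulr_ge0 ?addr_ge0 // ltW.
(* The orbit of [w] starts at exponent 1, so it bounds only products of at least two factors. The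
   single factor [w] is bounded by [N], from compactness of [L]. *)
have prodw m x : (0 < m)%N -> L x -> `|\prod_(j < m) w (iter j psi x)| <= M + N.
  case: m => // -[|m] _ Lx.
    by rewrite big_ord1; apply: le_trans (hN x Lx) _; rewrite lerDr ltW.
  rewrite big_ord_recr /= -{2}(ev_to_fs _ _ _ _ w_F) -ev_iter_weighted_comp//.
  by apply: le_trans (hM _ x _ Lx) _; [exists m.+1|rewrite lerDl ltW].
(* Here [c] compares [p] with sup bounds on [L], [M + N] bounds the weights, and [s] is the sup over
   [L'], which contains all the images of [L]. *)
exists (fun f => c * (M + N) * s f).
  split.
  - by move=> f; rewrite mulr_ge0.
  - by move=> f g; rewrite -mulrDr ler_wpM2l.
  - by move=> a f; rewrite sZ mulrCA.
  - move=> f; have kc : (fun=> c * (M + N) : K^o) @ f --> (c * (M + N) : K^o).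
      exact: cvg_cst.
    exact: (cvgM kc (sc f)).
move=> m f m0; rewrite -mulrA; apply: pc.
  by rewrite mulr_ge0// addr_ge0 ?ltW.
move=> x Lx; rewrite ev_iter_weighted_comp// normrM.
apply: ler_pM => //; first exact: prodw.
by apply: evs; apply: (psiL m m0); exists x.
Qed.

Theorem theorem3p7 (K : numFieldType) (Omega : topologicalType)
  (F : presheaf K Omega) (X : set Omega) (w : X -> K^o) (psi : X -> X)
  (hK : real_or_complex K)
  (Omega_lc : locally_compact [set: Omega])
  (Omega_sc : sigma_compact Omega)
  (Omega_nc : ~ compact [set: Omega])
  (Omega_T2 : hausdorff_space Omega)
  (F_sheaf : is_sheaf F)
  (F_F1 : F1 F)
  (F_co : forall Y : set Omega, open Y -> has_compact_open_topology F Y)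
  (X_open : open X)
  (w_cont : continuous w)
  (psi_cont : continuous psi)
  (C_def : wcomp_well_defined F w psi)
  (w_F : belongs (F X) w)
  (cond_a : exists2 Xn : nat -> set Omega, exhaustion X Xn &
    forall n (x : Omega), (X `\` closure (Xn n)) x ->
    forall W : set Omega, open W -> W `<=` X `\` closure (Xn n) -> W x ->
    exists U : set Omega, [/\ open U, U `<=` W, U x &
      dense (range (@restriction _ _ F X (Xn n `|` U)))])
  (cond_b : forall x : X, [set f : F X | ev f x = 0] <> [set: F X])
  (cond_c : forall m : nat, dense [set y : X | w (iter m psi y) <> 0]) :
  let C : F X -> F X := weighted_comp w psi in
  let orbit_w := [set iter m C (to_fs (F X) w) | m in [set m | (0 < m)%N]] in
  [<-> power_bounded C;
       m_topologizable C /\ bounded_in orbit_w;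
       topologizable C /\ bounded_in orbit_w;
       stable_orbits psi /\ bounded_in orbit_w].
Proof.
move=> C orbit_w.
have F_evc (f : F X) : continuous (ev f : X -> K^o) by case: (F_F1 X X_open).
tfae.
- move=> [Cc Cp]; split.
    split => // p /Cp[q qC pq]; exists q => //; exists 1 => // m x m0.
    by rewrite expr1n mul1r; exact: pq.
  apply/(bounded_in_fsP _ _ _ _ _ (F_co X X_open)) => L cL.
  have [p pC [evp _]] := sup_seminorm _ _ _ _ _ hK (F_co X X_open) F_evc cL.
  have [q [q_ge0 _ _ _] pq] := Cp p pC.
  (* Adding 1 makes the bound positive even if [q] vanishes at [w]. *)
  exists (q (to_fs (F X) w) + 1); first by rewrite ltr_wpDl.
  move=> _ x [m m0 <-] Lx; apply: le_trans (evp _ x Lx) _.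
  by apply: le_trans (pq _ _ m0) _; rewrite lerDl.
- move=> [[Cc Ct] ?]; split => //; split => // p /Ct[q qC [g g0 pq]].
  exists q => // m m0; exists (g ^+ m); first exact: exprn_gt0.
  by move=> x; exact: pq.
- move=> [Ct ?]; split => //.
  exact: topologizable_stable_orbits Ct.
- move=> [so bw]; apply: stable_orbits_power_bounded => //; exact: F_co.
Qed.
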